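(* Assume the continuum hypothesis. Then there is a non-P-point $\mathcal W$ in standard position on $\omega^2$ that has the three-functions property but is not $(2,4)$-weakly Ramsey.
   Context: Ultrafilters are nonprincipal. $\pi_1:\omega^2\to\omega$ is the first projection. A non-P-point in standard position is an ultrafilter $\mathcal W$ on $\omega^2$ such that $\pi_1$ is neither finite-to-one nor constant on any set in $\mathcal W$. $\mathcal W$ has the three-functions property if for every function $f$ on $\omega^2$ there is $H\in\mathcal W$ such that $f\restriction H$ is constant, or one-to-one, or equal to $g\circ\pi_1\restriction H$ for a one-to-one $g$ on $\omega$. $\mathcal W$ is $(n,t)$-weakly Ramsey if whenever $[\omega^2]^n$ is partitioned into finitely many pieces there is $H\in\mathcal W$ with $[H]^n$ meeting at most $t$ pieces. *)

(* Defs.v *)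
From mathcomp Require Import all_boot.
Set Implicit Arguments. Unset Strict Implicit. Unset Printing Implicit Defensive.

(* omega^2 is modelled as nat * nat; subsets of omega^2 as predicates. *)
Definition pset := nat * nat -> Prop.

Definition CH : Prop :=
  forall A : (nat -> bool) -> Prop,
    (exists e : nat -> (nat -> bool), forall x, A x -> exists n, e n = x) \/
    (exists g : (nat -> bool) -> (nat -> bool),
        (forall x, A (g x)) /\ (forall x y, g x = g y -> x = y)).

Definition finite_pset (A : pset) : Prop :=
  exists N, forall p, A p -> p.1 < N /\ p.2 < N.

Definition ultrafilter (W : pset -> Prop) : Prop :=
  [/\ W (fun _ => True),
      ~ W (fun _ => False),
      (forall A B : pset, W A -> (forall p, A p -> B p) -> W B),
      (forall A B : pset, W A -> W B -> W (fun p => A p /\ B p)) &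
      (forall A : pset, W A \/ W (fun p => ~ A p))].

Definition nonprincipal (W : pset -> Prop) : Prop :=
  forall A : pset, W A -> ~ finite_pset A.

Definition pi1_finite_to_one_on (H : pset) : Prop :=
  forall n, finite_pset (fun p => H p /\ p.1 = n).

Definition pi1_constant_on (H : pset) : Prop :=
  exists n, forall p, H p -> p.1 = n.

Definition non_P_point_standard (W : pset -> Prop) : Prop :=
  [/\ ultrafilter W, nonprincipal W &
      forall H : pset, W H -> ~ pi1_finite_to_one_on H /\ ~ pi1_constant_on H].

Definition three_functions_property (W : pset -> Prop) : Prop :=
  forall f : nat * nat -> nat,
    exists2 H : pset, W H &
      [\/ (exists c, forall p, H p -> f p = c),
          (forall p q, H p -> H q -> f p = f q -> p = q) |
          (exists g : nat -> nat, (forall m n, g m = g n -> m = n) /\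
                                  (forall p, H p -> f p = g p.1))].

(* An n-element subset of omega^2 is represented by a duplicate-free list of
   length n; a partition of [omega^2]^n into k pieces is a colouring of such
   lists by colours < k that does not depend on the order of the list. *)
Definition weakly_ramsey (n t : nat) (W : pset -> Prop) : Prop :=
  forall (k : nat) (c : seq (nat * nat) -> nat),
    (forall s, c s < k) ->
    (forall s s', perm_eq s s' -> c s = c s') ->
    exists2 H : pset, W H &
      exists T : seq nat, size T <= t /\
        forall s, uniq s -> size s = n -> (forall x, x \in s -> H x) ->
          c s \in T.

(* Main.v *)
Require Import Defs.
From mathcomp Require Import all_boot.
From mathcomp Require Import boolp wochoice.
From Stdlib Require Inverse_Image.
Set Implicit Arguments. Unset Strict Implicit. Unset Printing Implicit Defensive.

(** Identify each column of omega^2 with the tree of finite sequences of naturals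
    and call a subset of it big if it is somewhere dense; H is positive if
    infinitely many of its columns are big.  Non-big sets form an ideal, so every
    function is tame (constant, one-to-one, or an injection of the first
    coordinate) on a positive subset of any positive set: either infinitely many
    columns have a big fibre, or finitely many fibres never block a choice and a
    one-to-one restriction is built greedily.  Decreasing sequences of positive
    sets have positive lower bounds modulo finitely many columns, so under CH a
    tower of length omega_1 makes every function tame; tameness of indicator
    functions makes the generated filter ultra.  Colour a pair in one column by
    comparability in the tree, and a pair (a,b), (c,d) with a < c by the relative
    order of b, c, d: every positive set realizes all five colours. *)

(** * Somewhere dense subsets of the tree of finite sequences *)

Definition ext (s t : nat) : bool :=
  prefix (CodeSeq.decode s) (CodeSeq.decode t).

Definition child (s i : nat) : nat := CodeSeq.code (rcons (CodeSeq.decode s) i).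

Definition dense_above (s : nat) (A : nat -> Prop) : Prop :=
  forall t, ext s t -> exists2 u, ext t u & A u.

Definition big (A : nat -> Prop) : Prop := exists s, dense_above s A.

Lemma ext_refl s : ext s s.
Proof. exact: prefix_refl. Qed.

Lemma ext_trans s t u : ext s t -> ext t u -> ext s u.
Proof. exact: prefix_trans. Qed.

Lemma ext_child s i : ext s (child s i).
Proof. by rewrite /ext /child CodeSeq.codeK prefix_rcons. Qed.

Lemma child_incompatible s i j u :
  ext (child s i) u -> ext (child s j) u -> i = j.
Proof.
rewrite /ext /child !CodeSeq.codeK => /prefixP[x ->] /prefixP[y].
by rewrite !cat_rcons => /eqP; rewrite eqseq_cat // eqxx /= => /eqP[].
Qed.

Lemma dense_above_sub s (A B : nat -> Prop) :
  (forall u, A u -> B u) -> dense_above s A -> dense_above s B.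
Proof. by move=> AB dA t /dA[u tu /AB]; exists u. Qed.

Lemma big_sub (A B : nat -> Prop) : (forall u, A u -> B u) -> big A -> big B.
Proof. by move=> AB [s dA]; exists s; exact: dense_above_sub dA. Qed.

Lemma dense_above_ext s t A : ext s t -> dense_above s A -> dense_above t A.
Proof. by move=> st dA v tv; apply: dA; exact: ext_trans st tv. Qed.

(** Since [B] is not dense above [t], some [v] above [t] has no extension in [B]; density of [A]
    then gives a point above [v]. *)
Lemma dense_above_diff s (A B : nat -> Prop) :
  dense_above s A -> ~ big B -> dense_above s (fun u => A u /\ ~ B u).
Proof.
move=> dA nB t st; have /existsNP[v /not_implyP[tv nv]] : ~ dense_above t B.
  by move=> dB; apply: nB; exists t.
have [u vu Au] := dA v (ext_trans st tv).
exists u; first exact: ext_trans tv vu.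
by split=> // Bu; apply: nv; exists u.
Qed.

Lemma not_bigU (A B : nat -> Prop) :
  ~ big A -> ~ big B -> ~ big (fun u => A u \/ B u).
Proof.
move=> nA nB [s /dense_above_diff-/(_ _ nA) dB]; apply: nB; exists s.
by apply: dense_above_sub dB => u [[]].
Qed.

Lemma not_big_ltn n : ~ big (fun u => u < n).
Proof.
elim: n => [|n IHn]; first by move=> [s ds]; have [] := ds s (ext_refl s).
(* The cones above two distinct children of [s] are disjoint, so no single point lies in both. *)
have n1 : ~ big (fun u => u = n).
  move=> [s ds]; have [u s0 eu] := ds _ (ext_child s 0).
  have [v s1 ev] := ds _ (ext_child s 1); rewrite eu in s0; rewrite ev in s1.
  by have := child_incompatible s0 s1.
move=> b; apply: (not_bigU IHn n1); apply: big_sub b => u.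
by rewrite ltnS leq_eqVlt => /orP[/eqP|]; [right|left].
Qed.

Lemma dense_above_unbounded s A n :
  dense_above s A -> exists u, [/\ n <= u, ext s u & A u].
Proof.
move=> dA; have dA' := dense_above_diff dA (@not_big_ltn n).
have [u su [Au /negP]] := dA' s (ext_refl s).
by rewrite -leqNgt; exists u.
Qed.

Lemma big_unbounded A n : big A -> exists2 u, n <= u & A u.
Proof. by case=> s /(@dense_above_unbounded _ _ n)[u [? _ ?]]; exists u. Qed.

Lemma big_comparable A :
  big A -> exists u v, [/\ A u, A v, u != v & ext u v].
Proof.
case=> s dA; have [u su Au] := dA s (ext_refl s).
have [v [ltuv uv Av]] := dense_above_unbounded u.+1 (dense_above_ext su dA).
by exists u, v; split; rewrite // neq_ltn ltuv.
Qed.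

Lemma big_incomparable A :
  big A -> exists u v, [/\ A u, A v, ~~ ext u v & ~~ ext v u].
Proof.
case=> s dA; have [u s0u Au] := dA _ (ext_child s 0).
have [v s1v Av] := dA _ (ext_child s 1).
exists u, v; split=> //; apply/negP=> uv.
  by have := child_incompatible (ext_trans s0u uv) s1v.
by have := child_incompatible (ext_trans s1v uv) s0u.
Qed.

(** * Positive subsets of the plane *)

Definition column (H : pset) (a : nat) : nat -> Prop := fun u => H (a, u).

Definition positive (H : pset) : Prop :=
  forall N, exists2 a, N <= a & big (column H a).

Definition almost_sub (H K : pset) : Prop :=
  exists N, forall p, N <= p.1 -> H p -> K p.

Lemma almost_sub_refl H : almost_sub H H.
Proof. by exists 0. Qed.

Lemma almost_sub_trans H K L :
  almost_sub H K -> almost_sub K L -> almost_sub H L.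
Proof.
move=> [m HK] [n KL]; exists (maxn m n) => p.
by rewrite geq_max => /andP[mp np] /HK/KL; apply.
Qed.

Lemma almost_subI H K L :
  almost_sub H K -> almost_sub H L -> almost_sub H (fun p => K p /\ L p).
Proof.
move=> [m HK] [n HL]; exists (maxn m n) => p.
by rewrite geq_max => /andP[mp np] Hp; split; [exact: HK|exact: HL].
Qed.

Lemma sub_almost_sub (H K : pset) : (forall p, H p -> K p) -> almost_sub H K.
Proof. by move=> HK; exists 0 => p _; exact: HK. Qed.

Lemma positiveT : positive (fun _ => True).
Proof.
by move=> N; exists N => //; exists 0 => t _; exists t; rewrite ?ext_refl.
Qed.

Lemma positive_almost_sub H K : almost_sub H K -> positive H -> positive K.
Proof.
move=> [m HK] pH N; have [a] := pH (maxn m N).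
rewrite geq_max => /andP[ma Na] Ha; exists a => //.
by apply: big_sub Ha => u; exact: HK.
Qed.

(** Stage [n] contributes one column [a n], at or past [n], cut down to the sets [K 0] to [K n]. *)
Lemma positive_diagonal (K : nat -> pset) :
  (forall n, positive (fun p => forall i, i <= n -> K i p)) ->
  exists2 H, positive H & forall i, almost_sub H (K i).
Proof.
move=> pK; have /choice[a aP] n : exists a, n <= a /\
    big (column (fun p => forall i, i <= n -> K i p) a).
  by have [a] := pK n n; exists a.
exists (fun p => exists n, p.1 = a n /\ forall i, i <= n -> K i p).
  move=> n; have [na big_a] := aP n; exists (a n) => //.
  by apply: big_sub big_a => u Ku; exists n.
(* The bound exceeds every column chosen before stage [i], so points past it come from stages that
   respect [K i]. *)
move=> i; exists (\max_(n < i) (a n).+1) => p le_p [n [ep Kp]].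
case: (leqP i n) => [/Kp//|ltni].
have := leq_bigmax (F := fun n : 'I_i => (a n).+1) (Ordinal ltni).
by move=> /leq_trans-/(_ _ le_p) /=; rewrite ep ltnn.
Qed.

(** Among finitely many members of a chain one is almost contained in all the others, so finite
    intersections are positive and diagonalization applies. *)
Lemma positive_chain_bound (K : nat -> pset) :
  (forall i, positive (K i)) ->
  (forall i j, almost_sub (K i) (K j) \/ almost_sub (K j) (K i)) ->
  exists2 H, positive H & forall i, almost_sub H (K i).
Proof.
move=> pK Ktotal; apply: positive_diagonal => n.
suff [m sub_m] : exists m, almost_sub (K m) (fun p => forall i, i <= n -> K i p).
  exact: positive_almost_sub sub_m (pK m).
elim: n => [|n [m sub_m]].
  by exists 0; apply: sub_almost_sub => p Kp [].
have step k : almost_sub (K k) (fun p => forall i, i <= n -> K i p) ->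
    almost_sub (K k) (K n.+1) ->
    almost_sub (K k) (fun p => forall i, i <= n.+1 -> K i p).
  move=> /almost_subI/[apply]/almost_sub_trans; apply.
  apply: sub_almost_sub => p [le_n Sn] i.
  by rewrite leq_eqVlt => /orP[/eqP->|/le_n].
case: (Ktotal m n.+1) => [|lt]; first by exists m; exact: step.
exists n.+1; apply: step; last exact: almost_sub_refl.
exact: almost_sub_trans lt sub_m.
Qed.

(** * The three functions dichotomy on positive sets *)

Definition tame (f : nat * nat -> nat) (H : pset) : Prop :=
  [\/ (exists c, forall p, H p -> f p = c),
      (forall p q, H p -> H q -> f p = f q -> p = q) |
      (exists g : nat -> nat, (forall m n, g m = g n -> m = n) /\
                              (forall p, H p -> f p = g p.1))].

Lemma greedy_injection (T : Type) (g : T -> nat) (R : nat -> T -> Prop) :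
  (forall n (F : seq nat), exists x, R n x /\ g x \notin F) ->
  exists h : nat -> T, (forall n, R n (h n)) /\ injective (g \o h).
Proof.
move=> ex; have /choice[sel selP] (x : nat * seq nat) : exists y, R x.1 y /\ g y \notin x.2.
  exact: ex.
(* [hist n] lists the values of [g] used before stage [n], which the choice at stage [n] must
   avoid. *)
pose hist := fix hist n := if n is m.+1
  then g (sel (m, hist m)) :: hist m else [::].
pose h n := sel (n, hist n).
have histP m n : m < n -> g (h m) \in hist n.
  elim: n => // n IHn; rewrite ltnS leq_eqVlt /= inE.
  by move=> /orP[/eqP->|/IHn->]; rewrite ?eqxx ?orbT.
exists h; split=> [n|m n /= eg]; first by case: (selP (n, hist n)).
have neq i j : i < j -> g (h i) != g (h j).
  move=> /histP ij; apply: contraTneq ij => ->.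
  by case: (selP (j, hist j)).
by case: (ltngtP m n) => // /neq; rewrite eg eqxx.
Qed.

Lemma injection_extension (S : nat -> Prop) (g : nat -> nat) (b : bool) :
  (forall m n, S m -> S n -> g m = g n -> m = n) ->
  (forall m, S m -> odd (g m) = b) ->
  exists g', (forall m n, g' m = g' n -> m = n) /\ (forall m, S m -> g' m = g m).
Proof.
(* Outside [S] the values are distinct and of the parity opposite to [b], so they never collide with
   those on [S]. *)
move=> ginj gb; pose g' m := if `[<S m>] then g m else m.*2 + ~~ b.
have odd_out m : odd (m.*2 + ~~ b) = ~~ b by rewrite oddD odd_double oddb.
exists g'; split=> [m n|m Sm]; last by rewrite /g' asboolT.
rewrite /g'; case: asboolP => Sm; case: asboolP => Sn.
- exact: ginj.
- by move=> /(congr1 odd); rewrite odd_out gb //; case: b {gb g' odd_out}.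
- by move=> /(congr1 odd); rewrite odd_out gb //; case: b {gb g' odd_out}.
- by move=> /addIn/double_inj.
Qed.

(** Either one value has big fibres in infinitely many columns, giving a constant restriction, or
    each value has them in finitely many columns only, and columns with pairwise distinct values can
    be picked. *)
Lemma tame_of_big_fibres (f : nat * nat -> nat) H :
  (forall N, exists2 a, N <= a &
     exists c, big (column (fun p => H p /\ f p = c) a)) ->
  exists K : pset, [/\ positive K, forall p, K p -> H p & tame f K].
Proof.
pose Q c a := big (column (fun p => H p /\ f p = c) a) => exQ.
case: (EM (exists c, forall N, exists2 a, N <= a & Q c a)) => [[c pc]|nc].
  exists (fun p => H p /\ f p = c); split=> // [p []//|].
  by constructor 1; exists c => p [].
(* [g a] is a value with a big fibre in column [a], and 0 when there is none. *)
have /choice[g gP] a : exists c, (exists c', Q c' a) -> Q c a.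
  case: (EM (exists c, Q c a)) => [[c Qc]|nQ]; first by exists c.
  by exists 0.
have avoid (F : seq nat) : exists N, forall a, N <= a -> forall c, c \in F -> ~ Q c a.
  elim: F => [|c F [N NF]]; first by exists 0.
  have /existsNP[M Mc] : ~ forall N, exists2 a, N <= a & Q c a.
    by move=> pc; apply: nc; exists c.
  exists (maxn M N) => a; rewrite geq_max => /andP[Ma Na] d.
  rewrite inE => /orP[/eqP->|]; last exact: NF.
  by move=> Qc; apply: Mc; exists a.
have [|h [hP hinj]] := @greedy_injection nat g (fun n a => n <= a /\ Q (g a) a).
  move=> n F; have [N NF] := avoid F; have [a] := exQ (maxn N n).
  rewrite geq_max => /andP[Na na] /gP Qa; exists a; split=> //.
  by apply/negP => /(NF _ Na).
(* One parity is kept for the values of [g] on the chosen columns, so that the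
   other one is free for extending [g] to an injection of the whole of omega. *)
have [b bP] : exists b, forall N, exists2 n, N <= n & odd (g (h n)) = b.
  apply: contrapT => /forallNP nb.
  have /existsNP[M0 nt] := nb true; have /existsNP[M1 nf] := nb false.
  case e: (odd (g (h (maxn M0 M1)))); [apply: nt|apply: nf];
    by exists (maxn M0 M1); rewrite // ?leq_maxl ?leq_maxr.
pose S a := exists2 n, a = h n & odd (g a) = b.
have [|_ [_ _ //]|g' [g'inj g'P]] := @injection_extension S g b.
  by move=> _ _ [m -> _] [n -> _] /hinj->.
exists (fun p => S p.1 /\ (H p /\ f p = g p.1)); split=> [N|p [_ []]//|].
  have [n Nn gb] := bP N; have [nh Qh] := hP n.
  exists (h n); first exact: leq_trans nh.
  by apply: big_sub Qh => u Hu; split=> //; exists n.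
by constructor 3; exists g'; split=> // p [Sp [_ ->]]; rewrite g'P.
Qed.

Lemma tame_of_small_fibres (f : nat * nat -> nat) H N0 :
  positive H ->
  (forall a, N0 <= a -> forall c, ~ big (column (fun p => H p /\ f p = c) a)) ->
  exists K : pset, [/\ positive K, forall p, K p -> H p & tame f K].
Proof.
move=> pH small.
have /choice[s sP] a : exists s, big (column H a) -> dense_above s (column H a).
  case: (EM (big (column H a))) => [[s ds]|]; last by exists 0.
  by exists s.
have fresh a t (F : seq nat) : N0 <= a -> big (column H a) -> ext (s a) t ->
    exists u, [/\ ext t u, H (a, u) & f (a, u) \notin F].
  move=> Na bigH st.
  have nF : ~ big (fun u => H (a, u) /\ f (a, u) \in F).
    elim: F => [|c F IHF]; first by move=> [v dv]; have [u _ []] := dv v (ext_refl v).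
    move=> b; apply: (not_bigU (small a Na c) IHF); apply: big_sub b => u.
    rewrite inE => -[Hu /orP[/eqP fu|fu]]; first by left.
    by right.
  have [u tu [Hu nu]] := dense_above_diff (sP a bigH) nF st.
  by exists u; split=> //; apply/negP => fu; apply: nu.
(* The number [n] codes a demand: a point of [H] in column [a] above node [t]. If the demand is
   void, any point of [H] will do. *)
pose R n p := H p /\ forall a t, unpickle n = Some (a, t) ->
  N0 <= a -> big (column H a) -> ext (s a) t -> p.1 = a /\ ext t p.2.
have [|h [hP hinj]] := @greedy_injection _ f R.
  move=> n F; case: (EM (exists a t, [/\ unpickle n = Some (a, t),
      N0 <= a, big (column H a) & ext (s a) t])) => [[a [t [en Na Ha st]]]|ninv].
    have [u [tu Hu fu]] := fresh a t F Na Ha st.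
    exists (a, u); split=> //; split=> // a' t'.
    by rewrite en => -[<- <-].
  have [a Na Ha] := pH N0; have [u [_ Hu fu]] := fresh a _ F Na Ha (ext_refl _).
  exists (a, u); split=> //; split=> // a' t' en Na' Ha' st'.
  by case: ninv; exists a', t'.
exists (fun p => exists n, p = h n); split=> [N|_ [n ->]|].
- have [a] := pH (maxn N0 N); rewrite geq_max => /andP[N0a Na] Ha.
  exists a => //; exists (s a) => t st.
  have [_ /(_ a t (pickleK _) N0a Ha st)[ea tu]] := hP (pickle (a, t)).
  exists (h (pickle (a, t))).2 => //; exists (pickle (a, t)).
  by rewrite -{1}ea -surjective_pairing.
- by case: (hP n).
- by constructor 2 => _ _ [m ->] [n ->] /hinj->.
Qed.

Lemma positive_tame (f : nat * nat -> nat) H :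
  positive H -> exists K : pset, [/\ positive K, forall p, K p -> H p & tame f K].
Proof.
move=> pH; case: (EM (forall N, exists2 a, N <= a &
     exists c, big (column (fun p => H p /\ f p = c) a))) => [|/existsNP[N nN]].
  exact: tame_of_big_fibres.
by apply: (tame_of_small_fibres (N0 := N) pH) => a Na c b; apply: nN;
  exists a => //; exists c.
Qed.

(** * A tower of length omega_1 *)

(** If some initial segment of a well-order of the continuum is uncountable, take the least such: by
    CH the continuum injects into it, and the order pulled back along the injection has countable
    initial segments. *)
Lemma CH_well_order : CH ->
  exists lt : (nat -> bool) -> (nat -> bool) -> Prop,
    [/\ well_founded lt,
        (forall x y, [\/ x = y, lt x y | lt y x]) &
        (forall x, exists e : nat -> (nat -> bool),
           forall y, lt y x -> exists n, e n = y)].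
Proof.
move=> ch; have [R wo] := well_ordering_principle (nat -> bool).
pose lt x y := ~~ R y x.
have least (P : (nat -> bool) -> Prop) : (exists x, P x) ->
    exists2 x, P x & forall y, lt y x -> ~ P y.
  move=> [x0 Px0]; have [|x [[/asboolP Px minx] _]] := wo (fun x => `[<P x>]).
    by exists x0; apply/asboolP.
  exists x => // y + Py; rewrite /lt => /negP; apply; apply: minx.
  exact/asboolP.
have wf : well_founded lt.
  move=> x; apply: contrapT => nx.
  have [y ny miny] := least (fun x => ~ Acc lt x) (ex_intro _ x nx).
  by apply: ny; constructor => z /miny/contrapT.
have tri x y : [\/ x = y, lt x y | lt y x].
  have wch : wo_chain R predT by exact: withinW.
  have := wo_chainW wch (x := x) (y := y) isT isT.
  have := wo_chain_antisymmetric wch (x := x) (y := y) isT isT.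
  rewrite /lt; case: (R x y); case: (R y x) => //= anti _.
  - by constructor 1; exact: anti.
  - by constructor 2.
  - by constructor 3.
pose ctbl A := exists e : nat -> (nat -> bool), forall x, A x -> exists n, e n = x.
case: (EM (exists x, ~ ctbl (lt^~ x))) => [/least|/forallNP all_ctbl]; last first.
  by exists lt; split=> // x; apply: contrapT; exact: all_ctbl.
move=> [x nx minx]; case: (ch (lt^~ x)) => [//|[g [gx ginj]]].
exists (fun y z => lt (g y) (g z)); split=> [|y z|z].
- exact: (Inverse_Image.wf_inverse_image _ _ lt g wf).
- by case: (tri (g y) (g z)) => [/ginj|?|?]; [constructor 1|constructor 2|constructor 3].
have [e eP] := contrapT (minx _ (gx z)).
(* A left inverse of [g], arbitrary off its range, turns an enumeration below [g z] into one below
   [z]. *)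
have /choice[ginv ginvP] y : exists z, (exists y', g y' = y) -> g z = y.
  case: (EM (exists y', g y' = y)) => [[y' ?]|?]; first by exists y'.
  by exists y.
exists (fun n => ginv (e n)) => y /eP[n en]; exists n; apply: ginj.
by rewrite ginvP //; exists y.
Qed.

Lemma positive_tower (T : Type) (lt : T -> T -> Prop) (P : T -> pset -> Prop) :
  well_founded lt ->
  (forall x y, [\/ x = y, lt x y | lt y x]) ->
  (forall x, exists e : nat -> T, forall y, lt y x -> exists n, e n = y) ->
  (forall x H, positive H ->
     exists K : pset, [/\ positive K, forall p, K p -> H p & P x K]) ->
  exists H : T -> pset, forall x,
    [/\ positive (H x), P x (H x) & forall y, lt y x -> almost_sub (H x) (H y)].
Proof.
move=> wf tri ctbl dense.
pose good x (h : forall y, lt y x -> pset) (K : pset) :=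
  [/\ positive K, P x K & forall y (l : lt y x), almost_sub K (h y l)].
(* The whole plane is a default value; the induction below shows that a good set always exists. *)
pose step x h : pset :=
  if pselect (exists K, good x h K) is left e then projT1 (cid e) else fun _ => True.
pose H := Fix wf (fun _ => pset) step.
have HE x : H x = step x (fun y _ => H y).
  apply: Fix_eq => {}x f g fg; congr step.
  by apply: functional_extensionality_dep => y; apply: funext => l; exact: fg.
suff Hgood x : good x (fun y _ => H y) (H x) by exists H.
elim/(well_founded_ind wf): x => x IH; rewrite HE /step.
case: pselect => [e|]; [exact: projT2 (cid e)|case].
have [e eP] := ctbl x.
(* The enumeration [e] may leave the segment below [x]; such terms become the whole plane, which
   constrains nothing. *)
pose K n : pset := if pselect (lt (e n) x) is left _ then H (e n) else fun _ => True.
have [i|i j|L pL subL] := @positive_chain_bound K.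
- rewrite /K; case: pselect => [l|_]; last exact: positiveT.
  by case: (IH _ l).
- rewrite /K; case: pselect => [li|_]; last by right; exists 0.
  case: pselect => [lj|_]; last by left; exists 0.
  case: (tri (e i) (e j)) => [->|l|l]; first by left; exact: almost_sub_refl.
    by right; have [_ _] := IH _ lj; apply.
  by left; have [_ _] := IH _ li; apply.
have [M [pM ML PM]] := dense x L pL.
exists M; split=> // y l; apply: almost_sub_trans (sub_almost_sub ML) _.
have [n en] := eP y l; have := subL n; rewrite /K en.
by case: pselect.
Qed.

(** Lets the well-order of [nat -> bool] index all functions on the plane, each coded by its
    graph. *)
Lemma function_coding :
  exists D : (nat -> bool) -> (nat * nat -> nat), forall f, exists x, D x = f.
Proof.
pose graph (f : nat * nat -> nat) n : bool :=
  if unpickle n is Some (p, k) then f p == k else false.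
have graph_inj : injective graph.
  move=> f g efg; apply: funext => p.
  have := congr1 (fun x => x (pickle (p, g p))) efg.
  by rewrite /graph pickleK eqxx => /eqP.
have /choice[D DP] x : exists f, (exists f', graph f' = x) -> graph f = x.
  case: (EM (exists f, graph f = x)) => [[f ?]|?].
    by exists f.
  by exists (fun _ => 0).
exists D => f; exists (graph f); apply: graph_inj.
by apply: DP; exists f.
Qed.

(** * Five colours *)

Definition cross_colour (b c d : nat) : nat :=
  if b <= c then 2 else if b <= d then 3 else 4.

(** Within a column, 0 means incomparable and 1 comparable. Across columns the point of the earlier
    column comes first, which makes the colouring symmetric. *)
Definition pair_colour (p q : nat * nat) : nat :=
  if p.1 < q.1 then cross_colour p.2 q.1 q.2
  else if q.1 < p.1 then cross_colour q.2 p.1 p.2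
  else ext p.2 q.2 || ext q.2 p.2.

Definition colour (s : seq (nat * nat)) : nat :=
  if s is [:: p; q] then pair_colour p q else 0.

Lemma pair_colourC p q : pair_colour p q = pair_colour q p.
Proof. by rewrite /pair_colour; case: ltngtP => // _; rewrite orbC. Qed.

Lemma colour_lt5 s : colour s < 5.
Proof.
case: s => [|p [|q []]] //=; rewrite /pair_colour /cross_colour.
by do 4?case: ifP => // _; case: (_ || _).
Qed.

Lemma perm_pair (T : eqType) (p q : T) s :
  perm_eq [:: p; q] s -> s = [:: p; q] \/ s = [:: q; p].
Proof.
move=> eqs; have := perm_size eqs.
case: s eqs => [|x [|y []]] //= eqs _.
have : x \in [:: p; q] by rewrite (perm_mem eqs) mem_head.
rewrite !inE => /orP[]/eqP ex; subst x; [left|right].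
  by move: eqs; rewrite perm_cons => /perm_small_eq->.
by move: eqs; rewrite -[[:: p; q]]/([:: p] ++ [:: q]) perm_catC perm_cons => /perm_small_eq->.
Qed.

Lemma colour_perm s s' : perm_eq s s' -> colour s = colour s'.
Proof.
move=> eqs; have := perm_size eqs.
case: s eqs => [|p [|q [|r s]]] eqs /= sz.
- by case: s' sz {eqs}.
- by case: s' sz {eqs} => [|? []].
- by have [->|->] := perm_pair eqs; rewrite //= pair_colourC.
- by case: s' sz {eqs} => [|? [|? []]].
Qed.

(** Big columns are unbounded, so the order of choice decides the cross colours: a second column
    past [b] gives 2, [b] past [c] and then [d] past [b] gives 3, [b] past both [c] and [d] gives
    4. *)
Lemma positive_colours H i : positive H -> i < 5 ->
  exists p q, [/\ p != q, H p, H q & pair_colour p q = i].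
Proof.
move=> pH; have [a _ Ha] := pH 0; have [c ltac Hc] := pH a.+1.
case: i => [|[|[|[|[|//]]]]] _.
- have [u [v [Hu Hv uv vu]]] := big_incomparable Ha.
  exists (a, u), (a, v); split=> //; last first.
    by rewrite /pair_colour /= ltnn (negPf uv) (negPf vu).
  by apply: contraNneq uv => -[->]; exact: ext_refl.
- have [u [v [Hu Hv neq uv]]] := big_comparable Ha.
  exists (a, u), (a, v); split=> //; last by rewrite /pair_colour /= ltnn uv.
  by apply: contraNneq neq => -[->].
- have [b _ Hb] := big_unbounded 0 Ha; have [e] := pH (maxn a.+1 b).
  rewrite geq_max => /andP[ae be] He; have [d _ Hd] := big_unbounded 0 He.
  exists (a, b), (e, d); split=> //; last by rewrite /pair_colour /= ae /cross_colour be.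
  by apply/eqP => -[ea _]; rewrite ea ltnn in ae.
- have [b ltcb Hb] := big_unbounded c.+1 Ha; have [d ltbd Hd] := big_unbounded b Hc.
  exists (a, b), (c, d); split=> //.
    by apply/eqP => -[ea _]; rewrite ea ltnn in ltac.
  by rewrite /pair_colour /= ltac /cross_colour leqNgt ltcb ltbd.
- have [d _ Hd] := big_unbounded 0 Hc.
  have [b] := big_unbounded (maxn c d).+1 Ha.
  rewrite gtn_max => /andP[cb db] Hb.
  exists (a, b), (c, d); split=> //.
    by apply/eqP => -[ea _]; rewrite ea ltnn in ltac.
  by rewrite /pair_colour /= ltac /cross_colour leqNgt cb leqNgt db.
Qed.

(** * Positive sets as members of an ultrafilter *)

Lemma positive_not_finite H : positive H -> ~ finite_pset H.
Proof.
move=> pH [N HN]; have [a Na Ha] := pH N; have [u _ Hu] := big_unbounded 0 Ha.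
by have [] := HN _ Hu; rewrite /= ltnNge Na.
Qed.

Lemma positive_projection H :
  positive H -> ~ pi1_finite_to_one_on H /\ ~ pi1_constant_on H.
Proof.
move=> pH; split=> [fin|[n Hn]].
  have [a _ Ha] := pH 0; have [N HN] := fin a.
  have [u Nu Hu] := big_unbounded N Ha.
  by have [] := HN (a, u) (conj Hu erefl); rewrite /= [u < N]ltnNge Nu.
have [a na Ha] := pH n.+1; have [u _ Hu] := big_unbounded 0 Ha.
by have := Hn _ Hu => /= ea; rewrite ea ltnn in na.
Qed.

(* A two-valued function is neither one-to-one on a positive set nor an
   injective function of the first coordinate there. *)
Lemma tame_indicator (A H : pset) : positive H ->
  tame (fun p => `[<A p>] : nat) H ->
  (forall p, H p -> A p) \/ (forall p, H p -> ~ A p).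
Proof.
move=> pH; have nocol (g : nat -> nat) : (forall m n, g m = g n -> m = n) ->
    ~ (forall p, H p -> `[<A p>] = g p.1 :> nat).
  move=> ginj gE; have [a _ Ha] := pH 0; have [b ab Hb] := pH a.+1.
  have [c bc Hc] := pH b.+1.
  have [u _ /gE/= ga] := big_unbounded 0 Ha.
  have [v _ /gE/= gb] := big_unbounded 0 Hb.
  have [w _ /gE/= gc] := big_unbounded 0 Hc.
  have nab : g a <> g b by move=> /ginj e; rewrite e ltnn in ab.
  have nbc : g b <> g c by move=> /ginj e; rewrite e ltnn in bc.
  have nac : g a <> g c by move=> /ginj e; have := ltn_trans ab bc; rewrite e ltnn.
  move: nab nbc nac; rewrite -ga -gb -gc.
  by case: `[<A (a, u)>]; case: `[<A (b, v)>]; case: `[<A (c, w)>].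
case=> [[c cE]|inj|[g [ginj gE]]]; last by case: (nocol g).
- have [a _ Ha] := pH 0; have [u _ Hu] := big_unbounded 0 Ha.
  case: (EM (A (a, u))) => Au; [left|right] => p Hp.
    by have := cE _ Hp; rewrite -(cE _ Hu) (asboolT Au); case: asboolP.
  by have := cE _ Hp; rewrite -(cE _ Hu) (asboolF Au); case: asboolP.
- have [a _ Ha] := pH 0; have [u _ Hu] := big_unbounded 0 Ha.
  have [v uv Hv] := big_unbounded u.+1 Ha; have [w vw Hw] := big_unbounded v.+1 Ha.
  have nuv : `[<A (a, u)>] <> `[<A (a, v)>] :> nat.
    by move=> /(inj _ _ Hu Hv)[e]; rewrite e ltnn in uv.
  have nvw : `[<A (a, v)>] <> `[<A (a, w)>] :> nat.
    by move=> /(inj _ _ Hv Hw)[e]; rewrite e ltnn in vw.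
  have nuw : `[<A (a, u)>] <> `[<A (a, w)>] :> nat.
    by move=> /(inj _ _ Hu Hw)[e]; have := ltn_trans uv vw; rewrite e ltnn.
  move: nuv nvw nuw.
  by case: `[<A (a, u)>]; case: `[<A (a, v)>]; case: `[<A (a, w)>].
Qed.

(** * The ultrafilter generated by the tower *)

Theorem mainTheorem7 :
  CH ->
  exists W : pset -> Prop,
    [/\ non_P_point_standard W, three_functions_property W &
        ~ weakly_ramsey 2 4 W].
Proof.
move=> /CH_well_order[lt [wf tri ctbl]]; have [D Dsurj] := function_coding.
have [|H HP] := @positive_tower _ lt (fun x => tame (D x)) wf tri ctbl.
  by move=> x K; exact: positive_tame.
pose W A := exists x, almost_sub (H x) A.
have Hchain x y : almost_sub (H x) (H y) \/ almost_sub (H y) (H x).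
  case: (tri x y) => [->|l|l]; first by left; exact: almost_sub_refl.
    by right; have [_ _] := HP y; apply.
  by left; have [_ _] := HP x; apply.
have Wpos A : W A -> positive A.
  by move=> [x /positive_almost_sub]; apply; case: (HP x).
have Wthree : three_functions_property W.
  move=> f; have [x <-] := Dsurj f; have [_ tx _] := HP x.
  by exists (H x) => //; exists x; exact: almost_sub_refl.
have WS (A B : pset) : W A -> (forall p, A p -> B p) -> W B.
  by move=> [x xA] AB; exists x; apply: almost_sub_trans xA (sub_almost_sub AB).
exists W; split=> //.
  split=> [|A /Wpos/positive_not_finite//|A /Wpos/positive_projection//].
  split=> //.
  - by exists (fun _ => true); exact: sub_almost_sub.
  - by move=> /Wpos/positive_not_finite; apply; exists 0.
  - move=> A B [x xA] [y yB]; case: (Hchain x y) => xy.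
      by exists x; apply: almost_subI => //; exact: almost_sub_trans yB.
    by exists y; apply: almost_subI => //; exact: almost_sub_trans xA.
  - move=> A; have [K WK tK] := Wthree (fun p => `[<A p>] : nat).
    by have [KA|KA] := tame_indicator (Wpos _ WK) tK; [left|right]; exact: WS KA.
move=> /(_ 5 colour colour_lt5 colour_perm)[K /Wpos pK [T [sT colT]]].
(* The set [K] is positive, so its pairs force all five colours into [T], which has at most four
   entries. *)
have sub : {subset iota 0 5 <= T}.
  move=> i; rewrite mem_iota => /= lti.
  have [p [q [npq Kp Kq <-]]] := positive_colours pK lti.
  apply: (colT [:: p; q]); rewrite //= ?inE ?npq // => x.
  by rewrite !inE => /orP[]/eqP->.
by have := leq_trans (uniq_leq_size (iota_uniq 0 5) sub) sT.
Qed.
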